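(* Up to equivalence, the only $0,1$ matrix $M$ of size $4\times 4$ with $\mathrm{rank}_{\mathbb{R}}(M) = 3$ and $\mathrm{rank}_{\mathrm{bin}}(M) = \mathrm{rank}_{\mathbb{B}}(M) = i(M) = 4$ is the circulant matrix $$C_4 = \begin{pmatrix} 1&1&0&0\\ 0&1&1&0\\ 0&0&1&1\\ 1&0&0&1\end{pmatrix}.$$
   Context: Two matrices are equivalent if one can be obtained from the other by permuting rows, permuting columns, and possibly transposing. $\mathrm{rank}_{\mathbb{R}}(M)$ is the usual rank over $\mathbb{R}$. For a $0,1$ matrix $M$ of size $n\times m$, the binary rank $\mathrm{rank}_{\mathrm{bin}}(M)$ is the minimal $d$ for which there are $0,1$ matrices $A$ ($n\times d$) and $B$ ($d\times m$) with $M = A\cdot B$ over the integers; equivalently, the minimum number of all-one combinatorial rectangles (submatrices all of whose entries are $1$) needed to partition the ones of $M$. The Boolean rank $\mathrm{rank}_{\mathbb{B}}(M)$ is defined in the same way with Boolean arithmetic ($1+1=1$); equivalently, the minimum number of all-one combinatorial rectangles needed to cover the ones of $M$ (overlaps allowed). An isolation set of $M$ is a set of $1$-entries of $M$ such that no two of them are in the same row or column and no two of them belong to an all-one $2\times 2$ submatrix of $M$; $i(M)$ is the maximum size of an isolation set of $M$. *)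

(* Defs.v *)
(* The real numbers are an arbitrary [R : realType]. *)
From mathcomp Require Import all_boot all_order all_fingroup all_algebra.
From mathcomp Require Import reals.

Set Implicit Arguments.
Unset Strict Implicit.
Unset Printing Implicit Defensive.

Import GRing.Theory.
Local Open Scope ring_scope.

(* A 0,1 matrix is a matrix over [bool]; [mx01 R M] is the same matrix read   *)
(* with entries 0 and 1 in [R].  The library's ring structure on [bool]       *)
(* (addition is exclusive or) is never used on such matrices.                 *)
Definition mx01 (R : pzRingType) (m n : nat) (M : 'M[bool]_(m, n)) :
    'M[R]_(m, n) :=
  map_mx (fun b : bool => b%:R) M.

Definition real_rank (R : realType) (m n : nat) (M : 'M[bool]_(m, n)) : nat :=
  \rank (mx01 R M).

Definition bin_factor (m n : nat) (M : 'M[bool]_(m, n)) (d : nat) : bool :=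
  [exists A : 'M[bool]_(m, d), exists B : 'M[bool]_(d, n),
    mx01 int M == mx01 int A *m mx01 int B].

Definition bool_mulmx (m d n : nat) (A : 'M[bool]_(m, d))
    (B : 'M[bool]_(d, n)) : 'M[bool]_(m, n) :=
  \matrix_(i, j) \big[orb/false]_(k < d) (A i k && B k j).

Definition bool_factor (m n : nat) (M : 'M[bool]_(m, n)) (d : nat) : bool :=
  [exists A : 'M[bool]_(m, d), exists B : 'M[bool]_(d, n),
    M == bool_mulmx A B].

Lemma bin_factor_ex (m n : nat) (M : 'M[bool]_(m, n)) :
  exists d, bin_factor M d.
Proof.
exists m; apply/existsP; exists (\matrix_(i, j) (i == j)).
apply/existsP; exists M; apply/eqP.
rewrite -[LHS]mul1mx; congr (_ *m _).
by apply/matrixP=> i j; rewrite !mxE.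
Qed.

Lemma bool_factor_ex (m n : nat) (M : 'M[bool]_(m, n)) :
  exists d, bool_factor M d.
Proof.
exists m; apply/existsP; exists (\matrix_(i, j) (i == j)).
apply/existsP; exists M; apply/eqP/matrixP=> i j; rewrite mxE.
rewrite (bigD1 i) //= mxE eqxx /= big1 ?orbF // => k neq_ki.
by rewrite mxE eq_sym (negbTE neq_ki).
Qed.

Definition bin_rank (m n : nat) (M : 'M[bool]_(m, n)) : nat :=
  ex_minn (bin_factor_ex M).

Definition bool_rank (m n : nat) (M : 'M[bool]_(m, n)) : nat :=
  ex_minn (bool_factor_ex M).

Definition in_allone_2x2 (m n : nat) (M : 'M[bool]_(m, n))
    (x y : 'I_m * 'I_n) : bool :=
  [exists i1 : 'I_m, exists i2 : 'I_m, exists j1 : 'I_n, exists j2 : 'I_n,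
    [&& i1 != i2, j1 != j2,
        M i1 j1, M i1 j2, M i2 j1, M i2 j2,
        x.1 \in [:: i1; i2], x.2 \in [:: j1; j2],
        y.1 \in [:: i1; i2] & y.2 \in [:: j1; j2]]].

Definition isolation_set (m n : nat) (M : 'M[bool]_(m, n))
    (S : {set 'I_m * 'I_n}) : bool :=
  [forall x in S, M x.1 x.2] &&
  [forall x in S, forall y in S, (x != y) ==>
    [&& x.1 != y.1, x.2 != y.2 & ~~ in_allone_2x2 M x y]].

Definition isolation_number (m n : nat) (M : 'M[bool]_(m, n)) : nat :=
  \max_(S : {set 'I_m * 'I_n} | isolation_set M S) #|S|.

(* Stated for square matrices, where a matrix and its transpose have the same *)
(* type.                                                                      *)
Definition mx_equiv (n : nat) (M N : 'M[bool]_n) : Prop :=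
  exists s t : 'S_n,
    N = row_perm s (col_perm t M) \/ N = row_perm s (col_perm t M^T).

Definition C4 : 'M[bool]_4 :=
  \matrix_(i, j) nth false (nth [::]
    [:: [:: true;  true;  false; false];
        [:: false; true;  true;  false];
        [:: false; false; true;  true ];
        [:: true;  false; false; true ]] i) j.

(* Main.v *)
Require Import Defs.
From mathcomp Require Import all_boot all_order all_fingroup all_algebra.
From mathcomp Require Import reals.
From mathcomp Require Import ring.

(** An isolation set of size n in an n by n matrix M has exactly one entry in
    each row and each column, so permuting the columns of M moves it to the
    diagonal.  The resulting matrix N is all ones on the diagonal, and two
    diagonal entries (i, i), (j, j) span an all-one 2x2 submatrix exactly when
    N i j = N j i = 1.  Hence N is the identity plus the adjacency matrix of
    an oriented graph: a digraph without loops or 2-cycles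
    ([full_isolationP]).

    For n = 4, expand the determinant of N over permutations.  A permutation
    with a 2-cycle contributes nothing, so only the identity, the 3-cycles
    (even) and the 4-cycles (odd) remain, and
      det N = 1 + c3 - c4
    where c3 and c4 count the directed 3-cycles and 4-cycles of the graph
    ([det_oriented01]).  If the real rank is 3 then det N = 0, so c4 = 1 + c3
    is positive and the graph has a Hamiltonian cycle; relabel its vertices so
    that this cycle is 0 -> 1 -> 2 -> 3 -> 0.  Any further arc is a diagonal
    of this square.  It closes one directed triangle with two sides of the
    square, while no second Hamiltonian cycle can appear: one using a diagonal
    would have to run backwards along some side.  So det N is the number of
    diagonals, which must be 0, and N = C4 ([singular_hamiltonian],
    [C4_unique]).

    Conversely C4 is oriented in this sense, which gives every equivalent
    matrix isolation number 4; both other ranks are then 4 because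
      isolation number <= Boolean rank <= binary rank <= number of rows.
    The real rank of C4 is 3 because its left kernel is the line spanned by
    (1, -1, 1, -1).  Transposition reduces to permutations: the transpose of
    C4 is C4 with rows and columns renamed by i |-> - i modulo 4
    ([mx_equiv_C4]). *)

Set Implicit Arguments.
Unset Strict Implicit.
Unset Printing Implicit Defensive.

Import GRing.Theory Num.Theory.
Local Open Scope ring_scope.

(** * Isolation number, Boolean rank and binary rank *)

Lemma isolated_2x2 (m n : nat) (M : 'M[bool]_(m, n)) (x y : 'I_m * 'I_n) :
  M x.1 x.2 -> M y.1 y.2 -> x.1 != y.1 -> x.2 != y.2 ->
  in_allone_2x2 M x y = M x.1 y.2 && M y.1 x.2.
Proof.
case: x y => [i j] [k l] /= Mij Mkl neq_ik neq_jl.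
apply/idP/andP => [|[Mil Mkj]]; last first.
  apply/existsP; exists i; apply/existsP; exists k.
  apply/existsP; exists j; apply/existsP; exists l.
  by rewrite neq_ik neq_jl Mij Mil Mkj Mkl !inE !eqxx !orbT.
case/existsP=> i1 /existsP[i2 /existsP[j1 /existsP[j2]]].
case/and5P=> _ _ M11 M12 /and5P[M21 M22]; rewrite !inE /= => + + /andP[].
by do 4 ![case/pred2P=> ?]; subst; rewrite ?eqxx in neq_ik neq_jl.
Qed.

(** In a cover of the ones by rectangles, no rectangle contains two entries of
    an isolation set, since it would contain the 2x2 submatrix they span. *)
Lemma isolation_number_le_bool_rank (m n : nat) (M : 'M[bool]_(m, n)) :
  (isolation_number M <= bool_rank M)%N.
Proof.
rewrite /bool_rank; case: ex_minnP => d.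
case/existsP=> A /existsP[B /eqP defM] _.
apply/bigmax_leqP=> S /andP[/forall_inP MS /forall_inP isoS].
have MP i j : reflect (exists k, A i k && B k j) (M i j).
  rewrite defM mxE big_orE; exact: existsP.
have coverP x : x \in S -> exists k, A x.1 k && B k x.2 by move/MS/MP.
case: (set_0Vmem S) => [->|[x0 x0S]]; first by rewrite cards0.
(* S is nonempty, which supplies the default value of k outside S. *)
have [k0 _] := coverP x0 x0S.
pose k x := odflt k0 [pick k | A x.1 k && B k x.2].
have kP x : x \in S -> A x.1 (k x) && B (k x) x.2.
  by move/coverP=> [l Pl]; rewrite /k; case: pickP => [//|] /(_ l); rewrite Pl.
rewrite -[leqRHS]card_ord -(card_in_imset (f := k)) ?max_card // => x y xS yS.
move=> eqk; apply/eqP; apply: contraT => neq_xy.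
have /forall_inP/(_ y yS) := isoS x xS; rewrite neq_xy /=.
case/and3P=> neq1 neq2; rewrite isolated_2x2 ?MS //.
have /andP[Ax Bx] := kP x xS; have /andP[Ay By] := kP y yS.
case/negP; apply/andP; split; apply/MP; exists (k x).
  by rewrite Ax eqk.
by rewrite Bx eqk Ay.
Qed.

(** A factorization over the integers is also a Boolean one: an entry is
    nonzero exactly when some summand is. *)
Lemma bool_rank_le_bin_rank (m n : nat) (M : 'M[bool]_(m, n)) :
  (bool_rank M <= bin_rank M)%N.
Proof.
rewrite /bin_rank; case: ex_minnP => d.
case/existsP=> A /existsP[B /eqP /matrixP defM] _.
rewrite /bool_rank; case: ex_minnP => e _; apply.
apply/existsP; exists A; apply/existsP; exists B; apply/eqP/matrixP=> i j.
have := defM i j; rewrite !mxE big_orE => Mij.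
have {Mij} : (M i j)%:R = \sum_k (A i k && B k j)%:R :> int.
  rewrite Mij; apply: eq_bigr => k _; rewrite !mxE.
  by rewrite -natrM mulnb.
rewrite -natr_sum => /eqP; rewrite eqr_nat => /eqP Mij.
apply/idP/existsP => [Mt|[k /= ABk]]; last first.
  by rewrite -[M i j]lt0b Mij (bigD1 k) //= ABk.
apply/existsP; apply: contraT => /existsPn /= AB0.
by move: Mij; rewrite Mt big1 // => k _; rewrite (negbTE (AB0 k)).
Qed.

Lemma bin_rank_le_rows (m n : nat) (M : 'M[bool]_(m, n)) :
  (bin_rank M <= m)%N.
Proof.
rewrite /bin_rank; case: ex_minnP => d _; apply.
apply/existsP; exists (\matrix_(i, j) (i == j)); apply/existsP; exists M.
apply/eqP; rewrite -[LHS]mul1mx; congr (_ *m _).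
by apply/matrixP=> i j; rewrite !mxE.
Qed.

(** [N] is the identity plus the adjacency matrix of an oriented graph, a
    digraph without loops or 2-cycles. *)
Definition oriented (n : nat) (N : 'M[bool]_n) : Prop :=
  (forall i, N i i) /\ (forall i j, i != j -> ~~ (N i j && N j i)).

(** Since its entries lie in distinct rows and distinct columns, an isolation
    set of size n is the graph of a permutation, which [t] brings to the
    diagonal. *)
Lemma full_isolationP (n : nat) (M : 'M[bool]_n) :
  isolation_number M = n <-> exists t : 'S_n, oriented (col_perm t M).
Proof.
split=> [iM | [t [diag anti]]]; last first.
  apply/eqP; rewrite eqn_leq; apply/andP; split.
    apply: leq_trans (isolation_number_le_bool_rank M) _.
    exact: leq_trans (bool_rank_le_bin_rank M) (bin_rank_le_rows M).
  pose S := [set (i, t i) | i : 'I_n].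
  have MS i : M i (t i) by have := diag i; rewrite mxE.
  have cardS : #|S| = n.
    by rewrite card_imset ?card_ord // => i j [].
  suff isoS : isolation_set M S.
    have := leq_bigmax_cond (F := fun S : {set 'I_n * 'I_n} => #|S|) S isoS.
    by rewrite cardS.
  apply/andP; split; first by apply/forall_inP=> _ /imsetP[i _ ->] /=.
  apply/forall_inP=> _ /imsetP[i _ ->]; apply/forall_inP=> _ /imsetP[j _ ->].
  apply/implyP=> /= neq.
  have neq_ij : i != j by apply: contraNneq neq => ->.
  have neq_t : t i != t j by rewrite (inj_eq perm_inj).
  rewrite neq_ij neq_t isolated_2x2 //=.
  by have := anti i j neq_ij; rewrite !mxE.
have [|S isoS] := eq_bigmax_cond (fun S : {set 'I_n * 'I_n} => #|S|)
  (A := isolation_set M).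
  apply/card_gt0P; exists set0; rewrite unfold_in.
  by apply/andP; split; apply/forall_inP=> x; rewrite inE.
rewrite -/(isolation_number M) iM => /esym cardS.
case/andP: isoS => /forall_inP MS /forall_inP isoS.
have sep x y : x \in S -> y \in S -> x != y ->
    [/\ x.1 != y.1, x.2 != y.2 & ~~ (M x.1 y.2 && M y.1 x.2)].
  move=> xS yS neq; have /forall_inP/(_ y yS) := isoS x xS.
  rewrite neq /= => /and3P[n1 n2]; rewrite isolated_2x2 ?MS //.
have fst_inj : {in S &, injective fst}.
  move=> x y xS yS /eqP eq1; apply/eqP; apply: contraLR eq1 => neq.
  by have [] := sep x y xS yS neq.
have rowS i : exists j, (i, j) \in S.
  have: i \in fst @: S.
    suff ->: fst @: S = setT by rewrite inE.
    by apply/eqP; rewrite eqEcard subsetT cardsT card_ord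
                     (card_in_imset fst_inj) cardS leqnn.
  by case/imsetP=> [[i' j] xS ->]; exists j.
have [f fS] : {f : 'I_n -> 'I_n | forall i, (i, f i) \in S}.
  by exists (fun i => xchoose (rowS i)) => i; apply: (xchooseP (rowS i)).
have f_inj : injective f.
  move=> i j eqf; apply/eqP; apply: contraT => neq.
  have [|_] := sep _ _ (fS i) (fS j); last by rewrite /= eqf eqxx.
  by apply: contraNneq neq => -[->].
exists (perm f_inj); split=> [i|i j neq]; rewrite !mxE !permE.
  exact: MS (fS i).
have [|_ _ //] := sep _ _ (fS i) (fS j).
by apply: contraNneq neq => -[->].
Qed.

Lemma oriented_relabel (n : nat) (s : 'S_n) (N : 'M[bool]_n) :
  oriented N -> oriented (row_perm s (col_perm s N)).
Proof.
have entry i j : row_perm s (col_perm s N) i j = N (s i) (s j).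
  by rewrite !mxE.
move=> [diag anti]; split=> [i|i j neq_ij]; rewrite !entry //.
by rewrite anti // (inj_eq perm_inj).
Qed.

(** * Determinants of oriented 4x4 matrices *)

Lemma real_rank_perm (R : realType) (m n : nat) (s : 'S_m) (t : 'S_n)
    (M : 'M[bool]_(m, n)) :
  real_rank R (row_perm s (col_perm t M)) = real_rank R M.
Proof.
rewrite /real_rank /mx01 map_row_perm map_col_perm row_permE col_permE.
rewrite (eqmxMfull _ _) ?row_full_unit ?unitmx_perm //.
by rewrite mxrankMfree // row_free_unit unitmx_perm.
Qed.

Lemma real_rank_lt_det0 (R : realType) (n : nat) (N : 'M[bool]_n) :
  (real_rank R N < n)%N -> \det (mx01 R N) = 0.
Proof.
move=> lt_rk; apply/eqP; apply: contraTT lt_rk.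
rewrite -unitfE -unitmxE -row_free_unit => /eqP full.
by rewrite /real_rank full ltnn.
Qed.

(** The identity contributes 1 to the Leibniz formula, permutations with a
    2-cycle contribute 0, and what is left is the eight 3-cycles, of sign +1,
    and the six 4-cycles, of sign -1. *)
Lemma det_unit_oriented (R : comNzRingType) (A : 'M[R]_4) :
    (forall i, A i i = 1) -> (forall i j, i != j -> A i j * A j i = 0) ->
  \det A =
    1 + (A 0 1 * A 1 2 * A 2 0 + A 0 2 * A 2 1 * A 1 0 +
         A 0 1 * A 1 3 * A 3 0 + A 0 3 * A 3 1 * A 1 0 +
         A 0 2 * A 2 3 * A 3 0 + A 0 3 * A 3 2 * A 2 0 +
         A 1 2 * A 2 3 * A 3 1 + A 1 3 * A 3 2 * A 2 1)
      - (A 0 1 * A 1 2 * A 2 3 * A 3 0 + A 0 3 * A 3 2 * A 2 1 * A 1 0 +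
         A 0 1 * A 1 3 * A 3 2 * A 2 0 + A 0 2 * A 2 3 * A 3 1 * A 1 0 +
         A 0 2 * A 2 1 * A 1 3 * A 3 0 + A 0 3 * A 3 1 * A 1 2 * A 2 0).
Proof.
move=> diag anti.
(* Indexing by natural numbers lets the lifts of Laplace expansion compute. *)
pose f i j := A (inord i) (inord j).
have fE (i j : 'I_4) : A i j = f i j by rewrite /f !inord_val.
have defA : A = \matrix_(i < 4, j < 4) f i j by apply/matrixP=> i j; rewrite mxE.
have d (i : 'I_4) : f i i = 1 by rewrite -fE.
have a (i j : 'I_4) : i != j -> f i j * f j i = 0 by rewrite -!fE; exact: anti.
have d0 := d 0; have d1 := d 1; have d2 := d 2; have d3 := d 3.
have a01 := a 0 1 isT; have a02 := a 0 2 isT; have a03 := a 0 3 isT.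
have a12 := a 1 2 isT; have a13 := a 1 3 isT; have a23 := a 2 3 isT.
rewrite !fE defA; clearbody f; clear fE defA diag anti d a.
do 3 rewrite !(expand_det_row _ ord0) !big_ord_recl !big_ord0 /cofactor.
rewrite !det_mx11 !mxE /= /bump /= ?addn0 ?add0n ?addn1 ?add1n.
rewrite d0 d1 d2 d3.
ring: a01 a02 a03 a12 a13 a23.
Qed.

Lemma ord4_ind (P : 'I_4 -> Prop) : P 0 -> P 1 -> P 2 -> P 3 -> forall i, P i.
Proof.
move=> P0 P1 P2 P3 [[|[|[|[|//]]]] lt_i4].
- by rewrite (_ : Ordinal _ = 0) //; apply: val_inj.
- by rewrite (_ : Ordinal _ = 1) //; apply: val_inj.
- by rewrite (_ : Ordinal _ = 2) //; apply: val_inj.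
- by rewrite (_ : Ordinal _ = 3) //; apply: val_inj.
Qed.

(** The bound proofs inside ordinals are opaque, so these equations between
    integers modulo 4 do not hold by computation and have to be rewritten. *)
Lemma ord4_succ :
  (((0 + 1 = 1 :> 'I_4)%R * (1 + 1 = 2 :> 'I_4)%R) *
   ((2 + 1 = 3 :> 'I_4)%R * (3 + 1 = 0 :> 'I_4)%R))%type.
Proof. by do !split; apply: val_inj. Qed.

Lemma big_ord4 (V : nmodType) (F : 'I_4 -> V) :
  \sum_i F i = F 0 + F 1 + F 2 + F 3.
Proof.
rewrite !big_ord_recr big_ord0 /= add0r.
by congr (F _ + F _ + F _ + F _); apply: val_inj.
Qed.

Lemma perm4 (a b c d : 'I_4) : uniq [:: a; b; c; d] ->
  exists s : 'S_4, [/\ s 0 = a, s 1 = b, s 2 = c & s 3 = d].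
Proof.
move=> abcd_uniq; pose f := tnth [tuple a; b; c; d].
have f_inj : injective f by apply/tuple_uniqP.
by exists (perm f_inj); rewrite !permE.
Qed.

(** Reading indices modulo 4 shows C4 as the identity plus the directed
    4-cycle i -> i + 1, and makes its symmetries visible. *)
Lemma C4E (i j : 'I_4) : C4 i j = (j == i) || (j == i + 1).
Proof. by move: i j; do 2 apply: ord4_ind; rewrite mxE. Qed.

(** With 0,1 entries each product is a conjunction, so the two sums of
    [det_unit_oriented] are natural numbers that count cycles. *)
Lemma det_oriented01 (R : comNzRingType) (N : 'M[bool]_4) : oriented N ->
  \det (mx01 R N) =
    1 + ((N 0 1 && N 1 2 && N 2 0) + (N 0 2 && N 2 1 && N 1 0) +
         (N 0 1 && N 1 3 && N 3 0) + (N 0 3 && N 3 1 && N 1 0) +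
         (N 0 2 && N 2 3 && N 3 0) + (N 0 3 && N 3 2 && N 2 0) +
         (N 1 2 && N 2 3 && N 3 1) + (N 1 3 && N 3 2 && N 2 1))%:R
      - ((N 0 1 && N 1 2 && N 2 3 && N 3 0) +
         (N 0 3 && N 3 2 && N 2 1 && N 1 0) +
         (N 0 1 && N 1 3 && N 3 2 && N 2 0) +
         (N 0 2 && N 2 3 && N 3 1 && N 1 0) +
         (N 0 2 && N 2 1 && N 1 3 && N 3 0) +
         (N 0 3 && N 3 1 && N 1 2 && N 2 0))%:R.
Proof.
move=> [diag anti]; rewrite det_unit_oriented; first last.
- by move=> i j /anti; rewrite !mxE -natrM mulnb => /negbTE ->.
- by move=> i; rewrite mxE diag.
by rewrite !mxE -!natrM !mulnb -!natrD.
Qed.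

(** If none of the six 4-cycles is present, the determinant is 1 + c3 > 0. *)
Lemma singular_hamiltonian (R : numDomainType) (N : 'M[bool]_4) :
    oriented N -> \det (mx01 R N) = 0 ->
  exists s : 'S_4, forall i, N (s i) (s (i + 1)).
Proof.
have cycle (a b c d : 'I_4) : N a b && N b c && N c d && N d a ->
    uniq [:: a; b; c; d] ->
    exists s : 'S_4, forall i, N (s i) (s (i + 1)).
  move=> /andP[/andP[/andP[Nab Nbc] Ncd] Nda] /perm4[s [sa sb sc sd]].
  by exists s; apply: ord4_ind; rewrite ord4_succ ?sa ?sb ?sc ?sd.
move/det_oriented01=> ->.
do 6 ![case: (boolP (_ && _ && _ && _)) => [/cycle ham _|_];
  first exact: ham].
by rewrite subr0 nat1r => /eqP; rewrite pnatr_eq0.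
Qed.

(** Once the Hamiltonian cycle is in standard position, only four arcs are
    undetermined, the two orientations of each diagonal of the square, and the
    determinant is the number of them that are present. *)
Lemma C4_unique (R : numDomainType) (N : 'M[bool]_4) :
    oriented N -> (forall i, N i (i + 1)) -> \det (mx01 R N) = 0 -> N = C4.
Proof.
move=> orN cyc; have [diag anti] := orN.
have rev i : N (i + 1) i = false.
  apply/negbTE; have := anti i (i + 1); rewrite cyc; apply.
  by move: i; apply: ord4_ind.
have N01 := cyc 0; have N12 := cyc 1; have N23 := cyc 2; have N30 := cyc 3.
have N10 := rev 0; have N21 := rev 1; have N32 := rev 2; have N03 := rev 3.
rewrite !ord4_succ in N01 N12 N23 N30 N10 N21 N32 N03.
rewrite det_oriented01 //.
(* Only the 4-cycle 0 -> 1 -> 2 -> 3 -> 0 survives, and cancels the 1. *)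
rewrite N01 N12 N23 N30 N10 N21 N32 N03.
rewrite ?andbT ?andbF ?addn0 ?add0n /=.
rewrite addrAC subrr add0r => /eqP; rewrite pnatr_eq0 !addn_eq0 !eqb0.
case/andP=> /andP[/andP[/negbTE N20 /negbTE N13] /negbTE N02] /negbTE N31.
apply/matrixP=> i j; rewrite C4E.
by move: i j; do 2 apply: ord4_ind; rewrite ?diag.
Qed.

(** * The matrix C4 *)

(** A row vector [u] is killed by C4 exactly when cyclically consecutive
    entries sum to 0, so the left kernel is spanned by (1, -1, 1, -1). *)
Lemma real_rank_C4 (R : realType) : real_rank R C4 = 3%N.
Proof.
have mulC4 (u : 'rV[R]_4) i : (u *m mx01 R C4) 0 (i + 1) = u 0 i + u 0 (i + 1).
  rewrite mxE big_ord4 ![mx01 R C4 _ _]mxE !C4E.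
  by move: i; apply: ord4_ind; rewrite ord4_succ /=; ring.
pose v : 'rV[R]_4 := \row_(i < 4) (-1) ^+ i.
have ker_v : (kermx (mx01 R C4) :=: v)%MS.
  apply/eqmxP/andP; split; last first.
    apply/sub_kermxP/rowP=> j; rewrite -(subrK 1 j) mulC4 !mxE.
    by move: (j - 1); apply: ord4_ind; rewrite ord4_succ /=; ring.
  apply/rV_subP=> u /sub_kermxP uC4.
  have alt i : u 0 (i + 1) = - u 0 i.
    apply/eqP; rewrite -addr_eq0 addrC -mulC4 uC4 mxE //.
  have -> : u = u 0 0 *: v; last exact: scalemx_sub.
  have u1 := alt 0; have u2 := alt 1; have u3 := alt 2.
  rewrite !ord4_succ in u1 u2 u3.
  by apply/rowP; apply: ord4_ind; rewrite !mxE /= ?u3 ?u2 ?u1; ring.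
have := mxrank_ker (mx01 R C4).
rewrite ker_v rank_rV /real_rank.
have ->: v != 0.
  by apply/eqP=> /rowP/(_ 0)/eqP; rewrite !mxE oner_eq0.
have := rank_leq_row (mx01 R C4).
by case: (\rank _) => [|[|[|[|[]]]]].
Qed.

Lemma oriented_C4 : oriented C4.
Proof.
split=> [i|i j]; rewrite !C4E ?eqxx //.
by move: i j; do 2 apply: ord4_ind.
Qed.

(** Reflecting i |-> - i reverses the 4-cycle, as does transposing. *)
Lemma C4_tr_opp (i j : 'I_4) : C4 (- j) (- i) = C4 i j.
Proof. by rewrite !C4E; move: i j; do 2 apply: ord4_ind. Qed.

(** A transposition can be absorbed into the permutations, by
    [C4_tr_opp]. *)
Lemma mx_equiv_C4 (M : 'M[bool]_4) :
  mx_equiv M C4 <-> exists s t : 'S_4, C4 = row_perm s (col_perm t M).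
Proof.
split=> [[s [t [|eqC]]]|[s [t eqC]]]; [by exists s, t| |by exists s, t; left].
pose r := perm (@oppr_inj 'I_4).
exists (r * t)%g, (r * s)%g; apply/matrixP=> i j.
by rewrite -C4_tr_opp eqC !mxE !permM !permE.
Qed.

(** * Characterization of C4 *)

Local Close Scope ring_scope.

Theorem corollary19 (R : realType) (M : 'M[bool]_4) :
  [/\ real_rank R M = 3, bin_rank M = 4, bool_rank M = 4
    & isolation_number M = 4] <-> mx_equiv M C4.
Proof.
rewrite mx_equiv_C4; split=> [[rkM _ _ /full_isolationP[u orN]]|[s [t eqC]]].
  set N := col_perm u M in orN.
  have rkN : real_rank R N = 3.
    by have := real_rank_perm R 1%g u M; rewrite row_perm1 rkM.
  have [s ham] : exists s : 'S_4, forall i, N (s i) (s (i + 1)%R).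
    apply: (singular_hamiltonian (R := R) orN).
    by apply: real_rank_lt_det0; rewrite rkN.
  exists s, (s * u)%g; apply/esym; rewrite col_permM.
  apply: (C4_unique (R := R)); first exact: oriented_relabel.
    by move=> i; rewrite mxE [X in is_true X]mxE.
  by apply: real_rank_lt_det0; rewrite real_rank_perm rkN.
have iM : isolation_number M = 4.
  apply/full_isolationP; exists (s^-1 * t)%g.
  have -> : col_perm (s^-1 * t) M = row_perm s^-1 (col_perm s^-1 C4).
    by rewrite eqC; apply/matrixP=> i j; rewrite !mxE permM permKV.
  exact: oriented_relabel oriented_C4.
have bool_le := bool_rank_le_bin_rank M; have bin_le := bin_rank_le_rows M.
have := isolation_number_le_bool_rank M; rewrite iM => bool_ge.
split=> //; last 2 first.
- by apply/eqP; rewrite eqn_leq bin_le (leq_trans bool_ge).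
- by apply/eqP; rewrite eqn_leq bool_ge (leq_trans bool_le).
by rewrite -(real_rank_perm R s t) -eqC real_rank_C4.
Qed.
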